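(* Let $A$ and $B$ be $C^*$-algebras with $B$ unital, let $E$ be an $A$-$B$-equivalence bimodule, and let $\mathcal A\subset A$, $\mathcal B\subset B$ be dense Banach $*$-subalgebras with an $\mathcal A$-$\mathcal B$-pre-equivalence bimodule $\mathcal E\subset E$. Suppose $\mathcal B$ is spectral invariant in $B$ with the same unit. If $g\in\mathcal E$ is such that $\Theta_g:E\to E$, $\Theta_gf={}_\bullet\langle f,g\rangle g$, is invertible, then the canonical dual $\Theta_g^{-1}g$ is in $\mathcal E$ as well.
   Context: An $A$-$B$-equivalence bimodule is an $A$-$B$-bimodule $E$ that is a left Hilbert $A$-module with inner product ${}_\bullet\langle\cdot,\cdot\rangle$ (linear in the first variable) and a right Hilbert $B$-module with inner product $\langle\cdot,\cdot\rangle_\bullet$ (linear in the second variable) such that: (i) the linear span of $\{{}_\bullet\langle f,g\rangle: f,g\in E\}$ is dense in $A$ and that of $\{\langle f,g\rangle_\bullet: f,g\in E\}$ is dense in $B$; (ii) $\langle af,g\rangle_\bullet=\langle f,a^*g\rangle_\bullet$ and ${}_\bullet\langle fb,g\rangle={}_\bullet\langle f,gb^*\rangle$; (iii) ${}_\bullet\langle f,g\rangle h=f\langle g,h\rangle_\bullet$, for all $f,g,h\in E$, $a\in A$, $b\in B$. Given dense Banach $*$-subalgebras $\mathcal A\subset A$, $\mathcal B\subset B$ whose enveloping $C^*$-algebras are $A$ and $B$, an $\mathcal A$-$\mathcal B$-pre-equivalence bimodule is a dense subspace $\mathcal E\subset E$ which is an $\mathcal A$-$\mathcal B$-inner product submodule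 (so $\mathcal A\mathcal E\subset\mathcal E$, $\mathcal E\mathcal B\subset\mathcal E$, ${}_\bullet\langle\mathcal E,\mathcal E\rangle\subset\mathcal A$, $\langle\mathcal E,\mathcal E\rangle_\bullet\subset\mathcal B$) such that conditions (i)–(iii) hold with $\mathcal A,\mathcal B,\mathcal E$ in place of $A,B,E$. $\mathcal B$ is spectral invariant in $B$ (with the same unit) if whenever $b\in\mathcal B$ is invertible in $B$, then $b^{-1}\in\mathcal B$. *)

(* Defs.v *)
(* The complex numbers are R[i] for R : realType. *)
From HB Require Import structures.
From mathcomp Require Import all_boot all_order all_algebra.
From mathcomp Require Import complex.
From mathcomp Require Import all_classical all_reals all_analysis.
Import Order.TTheory GRing.Theory Num.Theory.
Import numFieldNormedType.Exports.
Set Implicit Arguments.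
Unset Strict Implicit.
Unset Printing Implicit Defensive.
Local Open Scope classical_set_scope.
Local Open Scope ring_scope.

(* MathComp rings are unital, so the product of a possibly non-unital
   C*-algebra is an operation of its own. *)
HB.mixin Record isCstarAlgebra (R : realType) (A : Type)
    of CompleteNormedModule R[i] A := {
  cmul : A -> A -> A;
  cstar : A -> A;
  cmulA : forall a b c : A, cmul a (cmul b c) = cmul (cmul a b) c;
  cmulDl : forall a b c : A, cmul (a + b) c = cmul a c + cmul b c;
  cmulDr : forall a b c : A, cmul a (b + c) = cmul a b + cmul a c;
  cmulZl : forall (k : R[i]) (a b : A), cmul (k *: a) b = k *: cmul a b;
  cmulZr : forall (k : R[i]) (a b : A), cmul a (k *: b) = k *: cmul a b;
  cstarK : forall a : A, cstar (cstar a) = a;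
  cstarD : forall a b : A, cstar (a + b) = cstar a + cstar b;
  cstarZ : forall (k : R[i]) (a : A), cstar (k *: a) = k^* *: cstar a;
  cstarM : forall a b : A, cstar (cmul a b) = cmul (cstar b) (cstar a);
  ler_norm_cmul : forall a b : A, `|cmul a b| <= `|a| * `|b|;
  norm_cstar_cmul : forall a : A, `|cmul (cstar a) a| = `|a| ^+ 2
}.

#[short(type="cstarAlgType")]
HB.structure Definition CstarAlgebra (R : realType) :=
  {A of isCstarAlgebra R A & CompleteNormedModule R[i] A}.

Notation "a ** b" := (cmul a b) (at level 40, left associativity) : ring_scope.

Section LinearSpan.
Variables (R : realType) (V : lmodType R[i]).
Implicit Types (S T X : set V) (nrm : V -> R[i]).

Definition linear_span X : set V :=
  [set v | exists (n : nat) (c : 'I_n -> R[i]) (x : 'I_n -> V),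
      (forall i, X (x i)) /\ v = \sum_(i < n) c i *: x i].

Definition is_subspace S : Prop :=
  [/\ S 0, forall u v, S u -> S v -> S (u + v) &
      forall (k : R[i]) v, S v -> S (k *: v)].

(* Norms are R[i]-valued, as in normedModType R[i]; recall that 0 < eps in R[i]
   forces eps to be real. *)
Definition norm_dense nrm S T : Prop :=
  forall v, S v -> forall eps : R[i], 0 < eps ->
    exists2 t, T t & nrm (v - t) < eps.

Definition norm_complete nrm S : Prop :=
  forall u : nat -> V, (forall n, S (u n)) ->
    (forall eps : R[i], 0 < eps -> exists N : nat, forall m n : nat,
        (N <= m)%N -> (N <= n)%N -> nrm (u m - u n) < eps) ->
    exists2 l, S l & forall eps : R[i], 0 < eps -> exists N : nat,
        forall n : nat, (N <= n)%N -> nrm (u n - l) < eps.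

Record is_norm_on nrm S : Prop := {
  norm_on_ge0 : forall v, S v -> 0 <= nrm v;
  norm_on_eq0 : forall v, S v -> nrm v = 0 -> v = 0;
  norm_onD : forall u v, S u -> S v -> nrm (u + v) <= nrm u + nrm v;
  norm_onZ : forall (k : R[i]) v, S v -> nrm (k *: v) = `|k| * nrm v
}.

End LinearSpan.

Section Algebras.
Variable R : realType.
Implicit Types A B C : cstarAlgType R.

Definition cpositive A (a : A) : Prop := exists x : A, a = cstar x ** x.

Definition is_unit_element B (e : B) : Prop :=
  forall b : B, e ** b = b /\ b ** e = b.

Definition is_inverse B (e b c : B) : Prop := b ** c = e /\ c ** b = e.

(* nrm is the Banach algebra norm of S; only its values on S matter. *)
Record banach_star_subalgebra A (S : set A) (nrm : A -> R[i]) : Prop := {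
  bsub_subspace : is_subspace S;
  bsub_mul : forall a b, S a -> S b -> S (a ** b);
  bsub_star : forall a, S a -> S (cstar a);
  bsub_norm : is_norm_on nrm S;
  bsub_complete : norm_complete nrm S;
  bsub_normM : forall a b, S a -> S b -> nrm (a ** b) <= nrm a * nrm b;
  bsub_norm_star : forall a, S a -> nrm (cstar a) = nrm a
}.

Record star_hom_on A C (S : set A) (phi : A -> C) : Prop := {
  shom_D : forall a b, S a -> S b -> phi (a + b) = phi a + phi b;
  shom_Z : forall (k : R[i]) a, S a -> phi (k *: a) = k *: phi a;
  shom_M : forall a b, S a -> S b -> phi (a ** b) = phi a ** phi b;
  shom_star : forall a, S a -> phi (cstar a) = cstar (phi a)
}.

(* A, with the inclusion of S, has the universal property of the enveloping
   C*-algebra of S. *)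
Definition enveloping_cstar A (S : set A) : Prop :=
  forall (C : cstarAlgType R) (phi : A -> C), star_hom_on S phi ->
    exists! psi : A -> C,
      star_hom_on setT psi /\ (forall a, S a -> psi a = phi a).

(* e is the unit of B *)
Definition spectral_invariant B (e : B) (S : set B) : Prop :=
  S e /\ forall b c : B, S b -> is_inverse e b c -> S c.

End Algebras.

(* The axioms relating the two pairings to the bimodule structure are in
   equivalence_bimodule below. *)
Record ipBimodule (R : realType) (A B : cstarAlgType R) := IPBimodule {
  ipb_sort :> lmodType R[i];
  lact : A -> ipb_sort -> ipb_sort;
  ract : ipb_sort -> B -> ipb_sort;
  lip : ipb_sort -> ipb_sort -> A;
  rip : ipb_sort -> ipb_sort -> B;
  lactDl : forall a a' f, lact (a + a') f = lact a f + lact a' f;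
  lactDr : forall a f g, lact a (f + g) = lact a f + lact a g;
  lactZl : forall (k : R[i]) a f, lact (k *: a) f = k *: lact a f;
  lactZr : forall (k : R[i]) a f, lact a (k *: f) = k *: lact a f;
  lactM : forall a a' f, lact (a ** a') f = lact a (lact a' f);
  ractDl : forall f g b, ract (f + g) b = ract f b + ract g b;
  ractDr : forall f b b', ract f (b + b') = ract f b + ract f b';
  ractZl : forall (k : R[i]) f b, ract (k *: f) b = k *: ract f b;
  ractZr : forall (k : R[i]) f b, ract f (k *: b) = k *: ract f b;
  ractM : forall f b b', ract f (b ** b') = ract (ract f b) b';
  lractA : forall a f b, ract (lact a f) b = lact a (ract f b)
}.

Section EquivalenceBimodules.
Variables (R : realType) (A B : cstarAlgType R) (E : ipBimodule A B).

Definition lnorm (f : E) : R[i] := sqrtC `|lip f f|.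
Definition rnorm (f : E) : R[i] := sqrtC `|rip f f|.

Record left_hilbert_module : Prop := {
  lip_linear : forall (k : R[i]) (f f' g : E),
    lip (k *: f + f') g = k *: lip f g + lip f' g;
  lip_act : forall (a : A) (f g : E), lip (lact a f) g = a ** lip f g;
  lip_star : forall f g : E, cstar (lip f g) = lip g f;
  lip_ge0 : forall f : E, cpositive (lip f f);
  lip_eq0 : forall f : E, lip f f = 0 -> f = 0;
  lip_complete : norm_complete lnorm setT
}.

Record right_hilbert_module : Prop := {
  rip_linear : forall (k : R[i]) (f g g' : E),
    rip f (k *: g + g') = k *: rip f g + rip f g';
  rip_act : forall (f g : E) (b : B), rip f (ract g b) = rip f g ** b;
  rip_star : forall f g : E, cstar (rip f g) = rip g f;
  rip_ge0 : forall f : E, cpositive (rip f f);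
  rip_eq0 : forall f : E, rip f f = 0 -> f = 0;
  rip_complete : norm_complete rnorm setT
}.

Record equivalence_conditions (SA : set A) (nA : A -> R[i])
    (SB : set B) (nB : B -> R[i]) (SE : set E) : Prop := {
  lip_full : norm_dense nA SA
    (linear_span [set a | exists f g : E, [/\ SE f, SE g & a = lip f g]]);
  rip_full : norm_dense nB SB
    (linear_span [set b | exists f g : E, [/\ SE f, SE g & b = rip f g]]);
  rip_lact : forall (a : A) (f g : E), SA a -> SE f -> SE g ->
    rip (lact a f) g = rip f (lact (cstar a) g);
  lip_ract : forall (b : B) (f g : E), SB b -> SE f -> SE g ->
    lip (ract f b) g = lip f (ract g (cstar b));
  lip_rip : forall f g h : E, SE f -> SE g -> SE h ->
    lact (lip f g) h = ract f (rip g h)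
}.

Record equivalence_bimodule : Prop := {
  eqb_left : left_hilbert_module;
  eqb_right : right_hilbert_module;
  eqb_conditions : equivalence_conditions
    setT (fun a : A => `|a|) setT (fun b : B => `|b|) setT
}.

(* On an equivalence bimodule lnorm and rnorm coincide, so density in E is
   unambiguous. *)
Record pre_equivalence_bimodule (SA : set A) (nA : A -> R[i])
    (SB : set B) (nB : B -> R[i]) (SE : set E) : Prop := {
  pre_subspace : is_subspace SE;
  pre_dense : norm_dense lnorm setT SE;
  pre_lact : forall a f, SA a -> SE f -> SE (lact a f);
  pre_ract : forall f b, SE f -> SB b -> SE (ract f b);
  pre_lip : forall f g, SE f -> SE g -> SA (lip f g);
  pre_rip : forall f g, SE f -> SE g -> SB (rip f g);
  pre_conditions : equivalence_conditions SA nA SB nB SE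
}.

Definition Theta (g f : E) : E := lact (lip f g) g.

End EquivalenceBimodules.

(* Main.v *)
Require Import Defs.
From HB Require Import structures.
From mathcomp Require Import all_boot all_order all_algebra.
From mathcomp Require Import complex.
From mathcomp Require Import all_classical all_reals all_analysis.
Import Order.TTheory GRing.Theory Num.Theory.
Import numFieldNormedType.Exports.
Local Open Scope classical_set_scope.
Local Open Scope ring_scope.

(** The identity <f, g>_A h = f <g, h>_B makes Theta_g a right multiplication:
    Theta_g f = f b with b := <g, g>_B, which lies in calB.  It is therefore
    enough to show that b is invertible in B: spectral invariance then puts its
    inverse c in calB, and Theta_g^-1 g = g c lies in calE.

    A left inverse of b comes from fullness of the right inner product.  As
    Theta_g is onto, every f' in E is (Theta_g^-1 f') b, so that
    <f, f'>_B = <f, Theta_g^-1 f'>_B b, and every linear combination of inner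
    products is a left multiple of b.  Some such combination u is at distance
    less than 1 from the unit e of B, and e is in turn a left multiple of u
    (near_unit_linv), hence of b.  Since b is self-adjoint, its left inverse is
    two-sided.

    The left inverse of u is the sum of the Neumann series of e - u, obtained
    here as the fixed point of the contraction x |-> e + x (e - u). *)

Section Contraction.
Set Implicit Arguments.
Unset Strict Implicit.
Variable R : realType.

(** Scalars with 0 <= q are real, which reduces this to the geometric sequence
    over R. *)
Lemma expr_complex_lt (q eps : R[i]) :
  0 <= q -> q < 1 -> 0 < eps -> exists n : nat, q ^+ n < eps.
Proof.
case: q eps => [r s] [e d]; rewrite lecE ltcE /= => /andP[/eqP -> r0].
rewrite ltcE /= => /andP[_ r1] /andP[/eqP -> e0].
have : geometric 1 r @ \oo --> (0 : R).
  by apply: cvg_geometric; rewrite ger0_norm.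
move=> /cvgr0Pnorm_lt /(_ _ e0) [N _ /(_ N (leqnn N))] /=.
rewrite mul1r ger0_norm ?exprn_ge0 // => rN; exists N.
have -> : (r +i* 0)%C = r%:C%C by [].
by rewrite -rmorphXn ltcE /= eqxx.
Qed.

(** The Banach fixed point theorem for complex scalars.  The iterates of 0
    stay in the ball of radius C = |T 0| / (1 - q), which T preserves; hence
    the iterates from rank n on are within q ^+ n * C of the n-th one. *)
Lemma contraction_fixpoint (V : completeNormedModType R[i])
    (T : V -> V) (q : R[i]) :
    0 <= q -> q < 1 -> (forall x y, `|T x - T y| <= q * `|x - y|) ->
  exists x, T x = x.
Proof.
move=> q0 q1 Tq.
pose u n := iter n T 0.
have q1' : 0 < 1 - q by rewrite subr_gt0.
pose C := `|T 0| / (1 - q).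
have C0 : 0 <= C by rewrite divr_ge0 // ltW.
have bound k : `|u k| <= C.
  elim: k => [|k IHk]; first by rewrite normr0.
  have -> : C = q * C + `|T 0|.
    by rewrite -[X in _ + X](divfK (lt0r_neq0 q1')) -/C mulrBr mulr1 mulrC subrKC.
  rewrite -[u k.+1](subrK (T 0)) (le_trans (ler_normD _ _)) // lerD2r.
  by rewrite (le_trans (Tq _ _)) // subr0 ler_wpM2l.
have contr n x y : `|iter n T x - iter n T y| <= q ^+ n * `|x - y|.
  elim: n => [|n IHn]; first by rewrite mul1r.
  by rewrite (le_trans (Tq _ _)) // exprS -mulrA ler_wpM2l.
have tail n k : `|u n - u (n + k)%N| <= q ^+ n * C.
  rewrite /u iterD (le_trans (contr _ _ _)) // ler_wpM2l ?exprn_ge0 //.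
  by rewrite sub0r normrN bound.
have /cauchy_cvgP ul : cauchy (u @ \oo).
  apply/cauchy_exP => eps eps0.
  (* C may vanish, so the bound on the tail is made positive first. *)
  have C1 : 0 < C + 1 by rewrite ltr_wpDl.
  have [N qN] := expr_complex_lt q0 q1 (divr_gt0 eps0 C1).
  exists (u N); exists N => // n /= /subnKC <-.
  rewrite -ball_normE /ball_ /= (le_lt_trans (tail _ _)) //.
  rewrite ltr_pdivlMr // in qN; apply: le_lt_trans qN.
  by rewrite ler_wpM2l ?exprn_ge0 // lerDl.
exists (lim (u @ \oo)); set l := lim _.
have ulS : (fun n => u n.+1) @ \oo --> l by rewrite cvg_shiftS.
have uT : (fun n => u n.+1) @ \oo --> T l.
  apply/cvgrPdist_lt => eps eps0.
  move/cvgrPdist_lt: ul => /(_ _ eps0); apply: filterS => n /= h.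
  rewrite (le_lt_trans (Tq _ _)) // (le_lt_trans _ h) //.
  by rewrite ler_piMl // ltW.
exact: (cvg_unique _ uT ulS).
Qed.

End Contraction.

Section CstarAlgebraFacts.
Set Implicit Arguments.
Unset Strict Implicit.
Variables (R : realType) (B : cstarAlgType R).
Implicit Types b c e u : B.

Lemma cmulBl b b' c : (b - b') ** c = b ** c - b' ** c.
Proof. by rewrite -scaleN1r cmulDl cmulZl scaleN1r. Qed.

Lemma cmulBr b c c' : b ** (c - c') = b ** c - b ** c'.
Proof. by rewrite -scaleN1r cmulDr cmulZr scaleN1r. Qed.

Lemma cmul0l c : 0 ** c = 0.
Proof. by rewrite -[in LHS](scale0r (0 : B)) cmulZl scale0r. Qed.

Lemma cmul_suml n (F : 'I_n -> B) c :
  (\sum_(i < n) F i) ** c = \sum_(i < n) (F i ** c).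
Proof.
by elim/big_rec2: _ => [|i x y _ <-]; rewrite ?cmul0l // cmulDl.
Qed.

Lemma cstar_unit e : is_unit_element e -> cstar e = e.
Proof.
move=> eP; have [h _] := eP (cstar e).
by rewrite -[LHS]h -{1}(cstarK e) -cstarM h cstarK.
Qed.

(** A fixed point v of x |-> e + x (e - u) satisfies v = e + v - v u. *)
Lemma near_unit_linv e u :
  is_unit_element e -> `|e - u| < 1 -> exists v, v ** u = e.
Proof.
move=> eP ltu1.
have [x y|v vP] := @contraction_fixpoint R B (fun x => e + x ** (e - u)) _
                      (normr_ge0 _) ltu1.
  by rewrite opprD addrACA subrr add0r -cmulBl mulrC ler_norm_cmul.
exists v; move: vP; rewrite cmulBr (eP v).2 addrCA -[RHS]addr0 => /addrI /eqP.
by rewrite subr_eq0 => /eqP.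
Qed.

(** The adjoint of a left inverse c is a right inverse, and it equals c. *)
Lemma selfadjoint_linv_inverse e b c :
  is_unit_element e -> cstar b = b -> c ** b = e -> is_inverse e b c.
Proof.
move=> eP bs cb; split=> //.
have bc' : b ** cstar c = e by rewrite -{1}bs -cstarM cb cstar_unit.
by rewrite -[c](eP c).2 -bc' (cmulA c) cb (eP _).1 bc'.
Qed.

End CstarAlgebraFacts.

Section EquivalenceBimoduleFacts.
Set Implicit Arguments.
Unset Strict Implicit.
Variables (R : realType) (A B : cstarAlgType R) (E : ipBimodule A B).

Lemma Theta_ract (g f : E) :
  equivalence_bimodule E -> Theta g f = ract f (rip g g).
Proof. by move=> hE; apply: (lip_rip (eqb_conditions hE)). Qed.

(** If right multiplication by b is onto, then the left ideal B b contains all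
    inner products, since <f, S f' b> = <f, S f'> b; so it is dense in B by
    fullness, and thus contains the unit. *)
Lemma ract_surj_linv (e b : B) (S : E -> E) :
    equivalence_bimodule E -> is_unit_element e ->
  (forall f, ract (S f) b = f) -> exists c, c ** b = e.
Proof.
move=> [_ hr hc] eP Sb.
have [_ [n [k [x [xP ->]]]] near] := rip_full hc (v := e) I ltr01.
have /choice[y yP] : forall i, exists y : B, y ** b = x i.
  move=> i; have [f [f' [_ _ ->]]] := xP i.
  by exists (rip f (S f')); rewrite -(rip_act hr) Sb.
have [v ve] := near_unit_linv eP near.
exists (v ** \sum_(i < n) k i *: y i); rewrite -cmulA cmul_suml -[RHS]ve.
by congr (_ ** _); apply: eq_bigr => i _; rewrite cmulZl yP.
Qed.

End EquivalenceBimoduleFacts.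

Theorem proposition3p21 (R : realType) (A B : cstarAlgType R)
  (oneB : B) (oneBP : is_unit_element oneB)
  (E : ipBimodule A B) (hE : equivalence_bimodule E)
  (calA : set A) (normA : A -> R[i])
  (hA : banach_star_subalgebra calA normA)
  (dense_calA : dense calA) (env_calA : enveloping_cstar calA)
  (calB : set B) (normB : B -> R[i])
  (hB : banach_star_subalgebra calB normB)
  (dense_calB : dense calB) (env_calB : enveloping_cstar calB)
  (calE : set E)
  (hcalE : pre_equivalence_bimodule calA normA calB normB calE)
  (spec_calB : spectral_invariant oneB calB)
  (g : E) (hg : calE g)
  (ThetaInv : E -> E)
  (ThetaK : cancel (Theta g) ThetaInv) (ThetaVK : cancel ThetaInv (Theta g)) :
  calE (ThetaInv g).
Proof.
set b := rip g g.
have Sb f : ract (ThetaInv f) b = f by rewrite -Theta_ract // ThetaVK.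
have [c cb] := ract_surj_linv hE oneBP Sb.
have bs : cstar b = b by exact: rip_star (eqb_right hE) _ _.
have bc := selfadjoint_linv_inverse oneBP bs cb.
have calBc : calB c by apply: spec_calB.2 bc; apply: (pre_rip hcalE).
suff -> : ThetaInv g = ract g c by apply: (pre_ract hcalE).
rewrite -[X in ract X c]Sb -ractM bc.1.
(* The unit acts trivially on E because every element has the form f b. *)
by rewrite -[LHS]Sb -(oneBP b).2 ractM Sb.
Qed.
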